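(* For $t\neq0$, $$\big\|e^{-it\Delta^2}\big\|_{\ell^1(\mathbb{Z})\to\ell^\infty(\mathbb{Z})}\lesssim|t|^{-\frac14},$$ with implied constant independent of $t$.
   Context: $(\Delta\phi)(n)=\phi(n+1)+\phi(n-1)-2\phi(n)$ on $\mathbb{Z}$ and $\Delta^2=\Delta\circ\Delta$, a bounded self-adjoint operator on $\ell^2(\mathbb{Z})$. *)

(* Defs.v *)
From HB Require Import structures.
From mathcomp Require Import all_boot all_order all_algebra.
From mathcomp Require Import all_classical all_reals all_analysis.
From mathcomp Require Import complex ring lra.
Set Implicit Arguments.
Unset Strict Implicit.
Unset Printing Implicit Defensive.
Import Order.TTheory GRing.Theory Num.Theory.
Import numFieldTopology.Exports numFieldNormedType.Exports.
Local Open Scope classical_set_scope.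
Local Open Scope complex_scope.
Local Open Scope ring_scope.

Section Definitions.
Context {R : realType}.

Definition zseq := int -> R[i].
Implicit Types (phi psi : zseq) (A U : zseq -> zseq).

(* Takes the value +oo when phi is not in l^p; only p in [1, +oo] is meant. *)
Definition lnorm (p : \bar R) phi : \bar R :=
  match p with
  | r%:E => ((\esum_(n in [set: int]) (Normc.normc (phi n) `^ r)%:E) `^ r^-1)%E
  | +oo%E => ereal_sup (range (fun n => (Normc.normc (phi n))%:E))
  | -oo%E => 0%E
  end.

Definition opnorm (p q : \bar R) A : \bar R :=
  ereal_sup [set lnorm q (A phi) | phi in [set phi | (lnorm p phi <= 1)%E]].

Definition linear_l2 A := forall (a : R[i]) phi psi,
  (lnorm 2%:E phi < +oo)%E -> (lnorm 2%:E psi < +oo)%E ->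
  A (a \*o phi \+ psi) = a \*o A phi \+ A psi.

(* A represents a bounded linear operator on l^2(Z); its values outside l^2 are
   irrelevant. That A maps l^2 into itself is linear_l2_lty. *)
Definition bounded_op A := linear_l2 A /\ (opnorm 2%:E 2%:E A < +oo)%E.

Definition expsum A (N : nat) : zseq -> zseq :=
  fun phi n => \sum_(k < N) (k`!%:R)^-1 * iter k A phi n.

Definition is_opexp A U :=
  bounded_op U /\
  opnorm 2%:E 2%:E (fun phi => U phi \- expsum A N phi) @[N --> \oo] --> 0%E.

(* The exponential of a bounded operator A on l^2(Z), i.e. the sum of the
   exponential series in operator norm; see opexpP for existence and
   is_opexp_unique for uniqueness on l^2. Only the values of opexp A on l^2,
   which contains l^1, are meaningful. *)
Definition opexp A : zseq -> zseq :=
  if pselect (exists U, is_opexp A U) is left exU then projT1 (cid exU)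
  else idfun.

Definition laplacian phi : zseq :=
  fun n => phi (n + 1) + phi (n - 1) - 2 * phi n.

Definition bilaplacian phi : zseq := laplacian (laplacian phi).

(* l2le phi a <-> lnorm 2 phi <= a, for 0 <= a *)
Definition l2le phi (a : R) :=
  forall s : seq int, uniq s -> \sum_(n <- s) Normc.normc (phi n) ^+ 2 <= a ^+ 2.

Lemma normc_ge0 (z : R[i]) : 0 <= Normc.normc z.
Proof. by case: z => x y; exact: sqrtr_ge0. Qed.

Lemma sqr_normcE (z : R[i]) : Normc.normc z ^+ 2 = complex.Re z ^+ 2 + complex.Im z ^+ 2.
Proof. by case: z => x y /=; rewrite sqr_sqrtr // addr_ge0 ?sqr_ge0. Qed.

Lemma lnorm2_ge0 phi : (0 <= lnorm 2%:E phi)%E.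
Proof. exact: poweR_ge0. Qed.

Lemma esum2P phi (a : R) :
  (\esum_(n in [set: int]) (Normc.normc (phi n) `^ 2)%:E <= (a ^+ 2)%:E)%E <->
  l2le phi a.
Proof.
split=> [h s us|h].
- rewrite -lee_fin; apply: le_trans h.
  have -> : (\sum_(n <- s) Normc.normc (phi n) ^+ 2)%:E =
    (\sum_(n \in [set` s]) (Normc.normc (phi n) `^ 2)%:E)%E.
    rewrite -fsbig_seq // -sumEFin; apply: eq_bigr => n _.
    by rewrite powR_mulrn // normc_ge0.
  by apply: ereal_sup_ubound; exists [set` s] => //; split; [exact: finite_seq|exact: subsetT].
- apply: ge_ereal_sup => _ [F [finF _] <-].
  rewrite fsbig_finite //= sumEFin lee_fin.
  under eq_bigr do rewrite powR_mulrn ?normc_ge0 //.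
  by apply: h; exact: finmap.fset_uniq.
Qed.

Lemma lnorm2P phi (a : R) : 0 <= a -> (lnorm 2%:E phi <= a%:E)%E <-> l2le phi a.
Proof.
move=> a0; rewrite -esum2P /lnorm.
set S := (\esum_(n in _) _)%E.
have S0 : (0 <= S)%E by apply: esum_ge0 => n _; rewrite lee_fin powR_ge0.
have -> : (a ^+ 2)%:E = (a%:E `^ 2)%E by rewrite poweR_EFin powR_mulrn.
have e : ((S `^ 2^-1) `^ 2)%E = S.
  by rewrite -poweRrM mulVf ?pnatr_eq0 // poweRe1.
split=> h.
- rewrite -e; apply: gt0_ler_poweR => //; rewrite in_itv /= ?andbT ?leey ?lee_fin ?poweR_ge0 ?a0 //.
- have -> : a%:E = ((a%:E `^ 2) `^ 2^-1)%E.
    by rewrite -poweRrM mulfV ?pnatr_eq0 // poweRe1 // lee_fin.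
  by apply: gt0_ler_poweR => //; rewrite ?invr_ge0 ?in_itv /= ?S0 ?leey ?ler0n // lee_fin powR_ge0.
Qed.

Lemma lnorm2_lty phi : (lnorm 2%:E phi < +oo)%E -> exists2 a : R, 0 <= a & l2le phi a.
Proof.
move=> h; have f : lnorm 2%:E phi \is a fin_num by rewrite ge0_fin_numE // lnorm2_ge0.
have a0 := fine_ge0 (lnorm2_ge0 phi).
by exists (fine (lnorm 2%:E phi)) => //; rewrite -lnorm2P // fineK.
Qed.

Lemma l2le_lty phi a : 0 <= a -> l2le phi a -> (lnorm 2%:E phi < +oo)%E.
Proof. by move=> a0 /(lnorm2P _ a0) h; apply: le_lt_trans h (ltry _). Qed.

Lemma l2le_pt phi a n : 0 <= a -> l2le phi a -> Normc.normc (phi n) <= a.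
Proof.
move=> a0 /(_ [:: n] isT); rewrite big_seq1.
by rewrite ler_pXn2r // nnegrE ?normc_ge0.
Qed.

Lemma l2le0 phi : l2le phi 0 -> phi = (fun=> 0).
Proof.
move=> h; apply/funext => n; apply: Normc.eq0_normc; apply/eqP.
by rewrite eq_le normc_ge0 andbT (l2le_pt _ _ h).
Qed.

Lemma l2le_const0 : l2le (fun=> 0) 0.
Proof. by move=> s _; rewrite big1 ?expr0n // => n _; rewrite Normc.normc0 expr0n. Qed.

Lemma l2leW phi a b : 0 <= a -> a <= b -> l2le phi a -> l2le phi b.
Proof.
move=> a0 ab h s us; apply: le_trans (h s us) _.
by rewrite ler_pXn2r // nnegrE // (le_trans a0).
Qed.

Lemma l2leD phi psi a b : 0 <= a -> 0 <= b ->
  l2le phi a -> l2le psi b -> l2le (phi \+ psi) (a + b).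
Proof.
rewrite le_eqVlt => /predU1P[<- _|a0].
  by move=> /l2le0 -> h s us; rewrite add0r; under eq_bigr do rewrite /= add0r; exact: h.
rewrite le_eqVlt => /predU1P[<-|b0].
  by move=> h /l2le0 -> s us; rewrite addr0; under eq_bigr do rewrite /= addr0; exact: h.
move=> ha hb s us.
have le1 n : Normc.normc ((phi \+ psi) n) ^+ 2 <=
    (1 + b / a) * Normc.normc (phi n) ^+ 2 + (1 + a / b) * Normc.normc (psi n) ^+ 2.
  rewrite /=; set x := Normc.normc (phi n); set y := Normc.normc (psi n).
  apply: (@le_trans _ _ ((x + y) ^+ 2)).
    by rewrite ler_pXn2r ?nnegrE ?addr_ge0 ?normc_ge0 // le_normcD.
  rewrite -subr_ge0.
  have -> : (1 + b / a) * x ^+ 2 + (1 + a / b) * y ^+ 2 - (x + y) ^+ 2 =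
     (b * x - a * y) ^+ 2 / (a * b) by field; rewrite !gt_eqF.
  by rewrite divr_ge0 ?sqr_ge0 // mulr_ge0 // ltW.
apply: le_trans (ler_sum _ (fun n _ => le1 n)) _.
rewrite big_split /= -!mulr_sumr.
have -> : (a + b) ^+ 2 = (1 + b / a) * a ^+ 2 + (1 + a / b) * b ^+ 2.
  by field; rewrite !gt_eqF.
by apply: lerD; apply: ler_wpM2l; rewrite ?ha ?hb // addr_ge0 // divr_ge0 // ltW.
Qed.

Lemma l2leZ c phi a : l2le phi a -> l2le (c \*o phi) (Normc.normc c * a).
Proof.
move=> h s us; under eq_bigr do rewrite /= Normc.normcM exprMn.
by rewrite -mulr_sumr exprMn ler_wpM2l ?sqr_ge0 ?h.
Qed.

Lemma l2le_shift phi a (k : int) : l2le phi a -> l2le (fun n => phi (n + k)) a.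
Proof.
move=> h s us; have := h [seq n + k | n <- s]; rewrite big_map; apply.
by rewrite map_inj_uniq //; exact: addIr.
Qed.

Lemma linear_l2_0 A : linear_l2 A -> A (fun=> 0) = (fun=> 0).
Proof.
move=> lin; have l0 : (lnorm 2%:E (fun=> 0%R) < +oo)%E.
  exact: l2le_lty (lexx _) l2le_const0.
have := lin 1 _ _ l0 l0.
have -> : 1 \*o (fun=> 0) \+ (fun=> 0) = (fun=> 0) :> zseq.
  by apply/funext => n /=; rewrite mulr0 addr0.
move=> e; apply/funext => n; have := congr1 (@^~ n) e => /= /eqP.
by rewrite mul1r -subr_eq subrr => /eqP <-.
Qed.

Lemma linear_l2Z A c phi : linear_l2 A -> (lnorm 2%:E phi < +oo)%E ->
  A (c \*o phi) = c \*o A phi.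
Proof.
move=> lin h; have l0 : (lnorm 2%:E (fun=> 0%R) < +oo)%E.
  exact: l2le_lty (lexx _) l2le_const0.
have := lin c _ _ h l0; rewrite (linear_l2_0 lin) => e.
have a0 psi : psi \+ (fun=> 0) = psi :> zseq by apply/funext => n /=; rewrite addr0.
by rewrite -[c \*o phi]a0 e a0.
Qed.

Lemma opnorm2P A (M : R) : linear_l2 A -> 0 <= M ->
  (opnorm 2%:E 2%:E A <= M%:E)%E <->
  (forall phi a, 0 <= a -> l2le phi a -> l2le (A phi) (M * a)).
Proof.
move=> lin M0; split=> [bA phi a|h]; last first.
  apply: ge_ereal_sup => _ [phi /= hphi <-].
  by apply/lnorm2P => //; rewrite -[M]mulr1; apply: h => //; apply/lnorm2P.
rewrite le_eqVlt => /predU1P[<- /l2le0 ->|a0 h].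
  by rewrite (linear_l2_0 lin) mulr0; exact: l2le_const0.
have na : Normc.normc a%:C = a by rewrite /= expr0n addr0 sqrtr_sqr gtr0_norm.
have h1 : l2le (a%:C^-1 \*o phi) 1.
  by have := l2leZ a%:C^-1 h; rewrite Normc.normcV na mulVf ?gt_eqF.
have e : phi = a%:C \*o (a%:C^-1 \*o phi).
  apply/funext => n /=; rewrite mulrA mulfV ?mul1r //.
  by rewrite eq_complex /= eqxx andbT gt_eqF.
have -> : M * a = Normc.normc a%:C * M by rewrite na mulrC.
rewrite e (linear_l2Z _ lin (l2le_lty ler01 h1)).
apply: l2leZ; apply/lnorm2P => //; apply: le_trans bA.
by apply: ereal_sup_ubound; exists (a%:C^-1 \*o phi) => //=; apply/lnorm2P.
Qed.

Lemma opnorm2_ge0 A : linear_l2 A -> (0 <= opnorm 2%:E 2%:E A)%E.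
Proof.
move=> lin; apply: le_trans (lnorm2_ge0 (A (fun=> 0))) _; apply: ereal_sup_ubound.
exists (fun=> 0) => //=; apply: (@le_trans _ _ 0%E) => //.
exact: (lnorm2P (fun=> 0) (lexx 0)).2 l2le_const0.
Qed.

Lemma bounded_opP A : linear_l2 A ->
  (opnorm 2%:E 2%:E A < +oo)%E <-> exists2 M : R, 0 <= M &
  forall phi a, 0 <= a -> l2le phi a -> l2le (A phi) (M * a).
Proof.
move=> lin; have N0 := opnorm2_ge0 lin; split=> [f|[M M0 /opnorm2P h]]; last first.
  by apply: le_lt_trans (h _ _) (ltry M).
exists (fine (opnorm 2%:E 2%:E A)); first exact: fine_ge0.
by apply/opnorm2P => //; rewrite ?fine_ge0 // fineK // ge0_fin_numE.
Qed.

Lemma linear_l2_lty A phi : bounded_op A ->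
  (lnorm 2%:E phi < +oo)%E -> (lnorm 2%:E (A phi) < +oo)%E.
Proof.
move=> [lin /bounded_opP-/(_ lin)[M M0 h]] /lnorm2_lty[a a0 ha].
by apply: l2le_lty (h _ _ a0 ha); exact: mulr_ge0.
Qed.

Lemma bounded_opZ c A : bounded_op A -> bounded_op (fun phi => c \*o A phi).
Proof.
move=> bA; have [lin /bounded_opP-/(_ lin)[M M0 h]] := bA.
have l : linear_l2 (fun phi => c \*o A phi).
  move=> a phi psi hphi hpsi; rewrite lin //; apply/funext => n /=.
  by rewrite mulrDr mulrCA.
split => //; apply/bounded_opP => //.
exists (Normc.normc c * M) => [|phi a a0 ha]; first by rewrite mulr_ge0 ?normc_ge0.
by rewrite -mulrA; apply: l2leZ; exact: h.
Qed.

Lemma bounded_opD A U : bounded_op A -> bounded_op U ->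
  bounded_op (fun phi => A phi \+ U phi).
Proof.
move=> [lin /bounded_opP-/(_ lin)[M M0 h]] [lin' /bounded_opP-/(_ lin')[M' M'0 h']].
have l : linear_l2 (fun phi => A phi \+ U phi).
  move=> a phi psi hphi hpsi; rewrite lin // lin' //; apply/funext => n /=.
  by rewrite mulrDr addrACA.
split => //; apply/bounded_opP => //.
exists (M + M') => [|phi a a0 ha]; first by rewrite addr_ge0.
by rewrite mulrDl; apply: l2leD; rewrite ?mulr_ge0 //; [exact: h|exact: h'].
Qed.

Lemma bounded_op_comp A U : bounded_op A -> bounded_op U -> bounded_op (A \o U).
Proof.
move=> [lin /bounded_opP-/(_ lin)[M M0 h]] bU.
have [lin' /bounded_opP-/(_ lin')[M' M'0 h']] := bU.
have l : linear_l2 (A \o U).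
  by move=> a phi psi hphi hpsi /=; rewrite lin' // lin //; exact: linear_l2_lty.
split => //; apply/bounded_opP => //.
exists (M * M') => [|phi a a0 ha /=]; first by rewrite mulr_ge0.
by rewrite -mulrA; apply: h; [exact: mulr_ge0|exact: h'].
Qed.

Lemma bounded_op_shift (k : int) : bounded_op (fun phi n => phi (n + k)).
Proof.
have l : linear_l2 (fun phi n => phi (n + k)) by [].
split => //; apply/bounded_opP => //; exists 1 => // phi a a0 ha.
by rewrite mul1r; exact: l2le_shift.
Qed.

Lemma bounded_op_id : bounded_op idfun.
Proof.
split => //; apply/bounded_opP => //; exists 1 => // phi a a0 ha.
by rewrite mul1r.
Qed.

Lemma bounded_laplacian : bounded_op laplacian.
Proof.
have := bounded_opD (bounded_opD (bounded_op_shift 1) (bounded_op_shift (-1)))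
  (bounded_opZ (- 2) bounded_op_id).
congr bounded_op; apply/funext => phi; apply/funext => n.
by rewrite /laplacian /= mulNr.
Qed.

Lemma bounded_bilaplacian : bounded_op bilaplacian.
Proof. exact: bounded_op_comp bounded_laplacian bounded_laplacian. Qed.

Lemma bounded_expsum A N : bounded_op A -> bounded_op (expsum A N).
Proof.
move=> bA; elim: N => [|N IH].
  have := bounded_opZ 0 bounded_op_id.
  congr bounded_op; apply/funext => phi; apply/funext => n.
  by rewrite /expsum big_ord0 /= mul0r.
have bi k : bounded_op (fun phi => iter k A phi).
  elim: k => [|k]; [exact: bounded_op_id|exact: bounded_op_comp].
have := bounded_opD IH (bounded_opZ (N`!%:R)^-1 (bi N)).
congr bounded_op; apply/funext => phi; apply/funext => n.
by rewrite /expsum big_ord_recr.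
Qed.

Lemma exp_coeffM_ge0 (M : R) k : 0 <= M -> 0 <= exp_coeff M k.
Proof. by move=> M0; rewrite /exp_coeff /= divr_ge0 ?exprn_ge0. Qed.

Lemma l2le_iter A (M a : R) phi k : 0 <= M -> 0 <= a ->
  (forall phi a, 0 <= a -> l2le phi a -> l2le (A phi) (M * a)) ->
  l2le phi a -> l2le (iter k A phi) (M ^+ k * a).
Proof.
move=> M0 a0 h ha; elim: k => [|k IH]; first by rewrite mul1r.
by rewrite exprS -mulrA; apply: h => //; rewrite mulr_ge0 ?exprn_ge0.
Qed.

Lemma normc_nat k : Normc.normc (k%:R : R[i]) = k%:R.
Proof.
have -> : (k%:R : R[i]) = (k%:R : R)%:C by rewrite rmorph_nat.
by rewrite /= expr0n addr0 sqrtr_sqr ger0_norm.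
Qed.

Lemma l2le_term A (M a : R) phi k : 0 <= M -> 0 <= a ->
  (forall phi a, 0 <= a -> l2le phi a -> l2le (A phi) (M * a)) ->
  l2le phi a ->
  l2le (fun n => (k`!%:R)^-1 * iter k A phi n) (exp_coeff M k * a).
Proof.
move=> M0 a0 h ha; have := l2leZ (k`!%:R)^-1 (l2le_iter k M0 a0 h ha).
by rewrite Normc.normcV normc_nat mulrA /exp_coeff /= [_^-1 * _]mulrC.
Qed.

Lemma l2le_expsumB A (M a : R) phi N m : 0 <= M -> 0 <= a ->
  (forall phi a, 0 <= a -> l2le phi a -> l2le (A phi) (M * a)) ->
  l2le phi a -> (N <= m)%N ->
  l2le (expsum A m phi \- expsum A N phi)
    ((series (exp_coeff M) m - series (exp_coeff M) N) * a).
Proof.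
move=> M0 a0 h ha /subnKC <-; elim: (m - N)%N => [|d IH].
  rewrite addn0 subrr mul0r.
  have -> : expsum A N phi \- expsum A N phi = (fun=> 0).
    by apply/funext => n /=; rewrite subrr.
  exact: l2le_const0.
have -> : expsum A (N + d.+1) phi \- expsum A N phi =
   (expsum A (N + d) phi \- expsum A N phi) \+
   (fun n => ((N + d)`!%:R)^-1 * iter (N + d) A phi n).
  by apply/funext => n /=; rewrite addnS /expsum big_ord_recr /= addrAC.
rewrite addnS /series /= big_nat_recr //= -/(series _ _) addrAC mulrDl.
apply: l2leD; last exact: l2le_term.
- rewrite mulr_ge0 // subr_ge0; apply: nondecreasing_series => //.
  + by move=> k _ _; exact: exp_coeffM_ge0.
  + exact: leq_addr.
- by rewrite mulr_ge0 // exp_coeffM_ge0.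
- exact: IH.
Qed.

Lemma l2le_lim (u : nat -> zseq) phi a N :
  (forall n, complex.Re (u m n) @[m --> \oo] --> complex.Re (phi n)) ->
  (forall n, complex.Im (u m n) @[m --> \oo] --> complex.Im (phi n)) ->
  (forall m, (N <= m)%N -> l2le (u m) a) -> l2le phi a.
Proof.
move=> hr hi h s us.
have c : \sum_(n <- s) Normc.normc (u m n) ^+ 2 @[m --> \oo] -->
         \sum_(n <- s) Normc.normc (phi n) ^+ 2.
  apply: cvg_big => [|n _]; first exact: add_continuous.
  rewrite sqr_normcE; under eq_fun do rewrite sqr_normcE.
  by apply: cvgD; rewrite !expr2; under eq_fun do rewrite expr2; apply: cvgM.
rewrite -(cvg_lim _ c) //; apply: limr_le; first by apply/cvg_ex; eexists; exact: c.
by exists N => // m /= Nm; exact: h.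
Qed.

Lemma ReD (x y : R[i]) : complex.Re (x + y) = complex.Re x + complex.Re y.
Proof. by case: x; case: y. Qed.

Lemma ImD (x y : R[i]) : complex.Im (x + y) = complex.Im x + complex.Im y.
Proof. by case: x; case: y. Qed.

Lemma ReM (x y : R[i]) : complex.Re (x * y) =
  complex.Re x * complex.Re y - complex.Im x * complex.Im y.
Proof. by case: x; case: y. Qed.

Lemma ImM (x y : R[i]) : complex.Im (x * y) =
  complex.Re x * complex.Im y + complex.Im x * complex.Re y.
Proof. by case: x; case: y. Qed.

Lemma ReB (x y : R[i]) : complex.Re (x - y) = complex.Re x - complex.Re y.
Proof. by case: x; case: y. Qed.

Lemma ImB (x y : R[i]) : complex.Im (x - y) = complex.Im x - complex.Im y.
Proof. by case: x; case: y. Qed.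

Lemma Re_le_normc (z : R[i]) : `|complex.Re z| <= Normc.normc z.
Proof.
rewrite -(@ler_pXn2r _ 2) ?nnegrE ?normc_ge0 // sqr_normcE real_normK ?num_real //.
by rewrite lerDl sqr_ge0.
Qed.

Lemma Im_le_normc (z : R[i]) : `|complex.Im z| <= Normc.normc z.
Proof.
rewrite -(@ler_pXn2r _ 2) ?nnegrE ?normc_ge0 // sqr_normcE real_normK ?num_real //.
by rewrite lerDr sqr_ge0.
Qed.

Lemma expsum_cvg A phi n : bounded_op A -> (lnorm 2%:E phi < +oo)%E ->
  cvgn (fun N => complex.Re (expsum A N phi n)) /\
  cvgn (fun N => complex.Im (expsum A N phi n)).
Proof.
move=> [lin /bounded_opP-/(_ lin)[M M0 h]] /lnorm2_lty[a a0 ha].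
pose t k := (k`!%:R)^-1 * iter k A phi n.
have tle k : Normc.normc (t k) <= a * exp_coeff M k.
  rewrite mulrC; apply: (l2le_pt n _ (l2le_term k M0 a0 h ha)).
  by rewrite mulr_ge0 // exp_coeffM_ge0.
have E0 k : 0 <= a * exp_coeff M k by rewrite mulr_ge0 // exp_coeffM_ge0.
have cE : cvgn (series (fun k => a * exp_coeff M k)).
  have -> : (fun k => a * exp_coeff M k) = a *: exp_coeff M by [].
  exact: is_cvg_seriesZ (is_cvg_series_exp_coeff M).
have key (f : R[i] -> R) : {morph f : x y / x + y} -> f 0 = 0 ->
    (forall z, `|f z| <= Normc.normc z) -> cvgn (fun N => f (expsum A N phi n)).
  move=> fD f0 fle.
  have -> : (fun N => f (expsum A N phi n)) = series (fun k => f (t k)).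
    by apply/funext => N; rewrite /expsum (big_morph f fD f0) /series /= big_mkord.
  apply: normed_cvg; apply: series_le_cvg cE => // k.
    exact: normr_ge0.
  exact: le_trans (fle _) (tle k).
by split; apply: key => //; [exact: ReD|exact: Re_le_normc|exact: ImD|exact: Im_le_normc].
Qed.

Lemma is_opexp_exists A : bounded_op A -> exists U, is_opexp A U.
Proof.
move=> bA; have [lin /bounded_opP-/(_ lin)[M M0 h]] := bA.
pose U : zseq -> zseq := fun phi n =>
  limn (fun N => complex.Re (expsum A N phi n)) +i*
  limn (fun N => complex.Im (expsum A N phi n)).
pose e := limn (series (exp_coeff M)).
have nd : nondecreasing_seq (series (exp_coeff M)).
  by apply: nondecreasing_series => k _ _; exact: exp_coeffM_ge0.
have cM := is_cvg_series_exp_coeff M.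
have eN N : 0 <= e - series (exp_coeff M) N.
  by rewrite subr_ge0; exact: nondecreasing_cvgn_le.
have tail N phi a : 0 <= a -> l2le phi a ->
    l2le (U phi \- expsum A N phi) ((e - series (exp_coeff M) N) * a).
  move=> a0 ha; have fphi := l2le_lty a0 ha.
  apply: (@l2le_lim (fun m => expsum A m phi \- expsum A N phi) _ _ N).
  - move=> n; have [c _] := expsum_cvg n bA fphi.
    rewrite /= ReB; under eq_fun do rewrite ReB.
    by apply: cvgB => //; exact: cvg_cst.
  - move=> n; have [_ c] := expsum_cvg n bA fphi.
    rewrite /= ImB; under eq_fun do rewrite ImB.
    by apply: cvgB => //; exact: cvg_cst.
  - move=> m Nm.
    have Em : series (exp_coeff M) m <= e by exact: nondecreasing_cvgn_le.
    apply: (@l2leW _ ((series (exp_coeff M) m - series (exp_coeff M) N) * a)).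
    + by rewrite mulr_ge0 // subr_ge0 nd.
    + by rewrite ler_wpM2r // lerD2r.
    + exact: l2le_expsumB.
have linU : linear_l2 U.
  move=> c phi psi hphi hpsi; apply/funext => n /=.
  have [rphi iphi] := expsum_cvg n bA hphi.
  have [rpsi ipsi] := expsum_cvg n bA hpsi.
  have E N : expsum A N (c \*o phi \+ psi) n = c * expsum A N phi n + expsum A N psi n.
    by have [-> //] := bounded_expsum N bA.
  have cM' (z : R) (f : nat -> R) :
      cvgn f -> z * f N @[N --> \oo] --> z * limn f by exact: cvgMl_tmp.
  case: c E => x y E; rewrite /U; apply/eqP; rewrite eq_complex; apply/andP; split; apply/eqP.
  - apply: cvg_lim => //=; under eq_fun do rewrite E ReD ReM /=.
    by apply: cvgD => //; exact: cvgB (cM' _ _ rphi) (cM' _ _ iphi).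
  - apply: cvg_lim => //=; under eq_fun do rewrite E ImD ImM /=.
    by apply: cvgD => //; exact: cvgD (cM' _ _ iphi) (cM' _ _ rphi).
have linB N : linear_l2 (fun phi => U phi \- expsum A N phi).
  move=> c phi psi hphi hpsi; have [lE _] := bounded_expsum N bA.
  by rewrite linU // lE //; apply/funext => n /=; rewrite mulrBr opprD addrACA.
exists U; split.
  split => //; apply/bounded_opP => //; exists e => [|phi a a0 ha].
    by have := eN 0%N; rewrite /series /= big_geq // subr0.
  have := tail 0%N phi a a0 ha; rewrite [series _ 0%N]big_geq // subr0.
  congr l2le; apply/funext => n /=; by rewrite /expsum big_ord0 subr0.
apply: (@squeeze_cvge _ _ _ _ (cst 0%E) _ (fun N => (e - series (exp_coeff M) N)%:E)).
- near=> N; rewrite opnorm2_ge0 //=.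
  by apply/opnorm2P => // phi a a0 ha; exact: tail.
- exact: cvg_cst.
- apply: cvg_EFin; first by near=> N.
  rewrite -(subrr e); apply: cvgB => //; exact: cvg_cst.
Unshelve. all: by end_near.
Qed.

Lemma opexpP A : bounded_op A -> is_opexp A (opexp A).
Proof.
move=> /is_opexp_exists ex; rewrite /opexp.
by case: pselect => // ex'; case: cid.
Qed.

Lemma is_opexp_cvg A U phi n : bounded_op A -> is_opexp A U ->
  (lnorm 2%:E phi < +oo)%E ->
  Normc.normc (U phi n - expsum A N phi n) @[N --> \oo] --> 0.
Proof.
move=> bA [[linU _] cU] /lnorm2_lty[a a0 ha].
have linB N : linear_l2 (fun phi => U phi \- expsum A N phi).
  move=> c f g hf hg; have [lE _] := bounded_expsum N bA.
  by rewrite linU // lE //; apply/funext => k /=; rewrite mulrBr opprD addrACA.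
have a1 : 0 < a + 1 by rewrite ltr_wpDl.
apply/cvgr0Pnorm_le => e e0; have ea : 0 < e / (a + 1) by rewrite divr_gt0.
have : \forall N \near \oo,
    (opnorm 2%:E 2%:E (fun phi => U phi \- expsum A N phi)%R < (e / (a + 1))%:E)%E.
  apply: (cU [set x | (x < (e / (a + 1))%:E)%E]); apply: open_nbhs_nbhs.
    by split; [exact: open_ereal_lt_ereal|rewrite /= lte_fin].
apply: filterS => N /ltW /opnorm2P-/(_ (linB N) (ltW ea) _ _ a0 ha) hN.
rewrite ger0_norm ?normc_ge0 //; apply: le_trans (l2le_pt n _ hN) _.
  by rewrite mulr_ge0 // ltW.
by rewrite mulrAC ler_pdivrMr // ler_pM2l // lerDl.
Qed.

Lemma is_opexp_unique A U V phi : bounded_op A -> is_opexp A U -> is_opexp A V ->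
  (lnorm 2%:E phi < +oo)%E -> U phi = V phi.
Proof.
move=> bA eU eV hphi; apply/funext => n; apply/eqP; rewrite -subr_eq0; apply/eqP.
apply: Normc.eq0_normc; apply/eqP; rewrite eq_le normc_ge0 andbT.
have c : Normc.normc (U phi n - expsum A N phi n) +
    Normc.normc (V phi n - expsum A N phi n) @[N --> \oo] --> 0.
  by rewrite -[X in _ --> X]addr0; apply: cvgD; exact: is_opexp_cvg.
rewrite -(cvg_lim _ c) //.
apply: limr_ge; first by apply/cvg_ex; eexists; exact: c.
apply: nearW => N /=.
rewrite -[Normc.normc (V phi n - _)]normcN; apply: le_trans (le_normcD _ _).
by rewrite opprB addrA subrK.
Qed.

End Definitions.
Arguments zseq : clear implicits.
Arguments lnorm {R} p%_E phi.
Arguments opnorm {R} (p q)%_E A.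

(* Main.v *)
Require Import Defs.
From mathcomp Require Import all_boot all_order all_algebra.
From mathcomp Require Import all_classical all_reals all_analysis.
From mathcomp Require Import complex ring lra zify.
Set Implicit Arguments.
Unset Strict Implicit.
Unset Printing Implicit Defensive.
Import Order.TTheory GRing.Theory Num.Theory.
Import numFieldTopology.Exports numFieldNormedType.Exports.
Local Open Scope classical_set_scope.
Local Open Scope complex_scope.
Local Open Scope ring_scope.

(** By Fourier inversion, Delta^k phi (n) = sum_m phi(m) psi_k(n - m) with
    psi_k(n) = (1/pi) int_0^pi cos(n x) (2 cos x - 2)^k dx.  Summing the exponential
    series, the kernel of exp(-it Delta^2) is (1/pi) int_0^pi cos(n x) e^{-itw(x)^2} dx
    with w(x) = 2 cos x - 2, so it suffices to bound the integrals of cos(t w^2 + c x + th)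
    over [0, pi] by a multiple of |t|^{-1/4}, uniformly in c and th.
    Here (w^2)'' = 8 (1 - cos x)(1 + 2 cos x) vanishes only at 0 and 2pi/3, and
    cos x - cos y >= (y - x)^2 / 32 gives |(w^2)''| >= eps^2 / 4 at distance eps from
    these points.  Van der Corput's second derivative test bounds the integral there by
    8 (|t| eps^2 / 4)^{-1/2}, the excised neighbourhoods contribute O(eps), and
    eps = |t|^{-1/4} balances the two.
    Estimates of integrals are made on primitives, through the mean value theorem. *)

(** * Derivative rules and mean value estimates *)

Section Derivatives.
Context {R : realType}.
Implicit Types (f g F P : R -> R) (a b x : R).

Lemma is_deriveD_fun f g x (df dg : R) : is_derive x 1 f df -> is_derive x 1 g dg ->
  is_derive x 1 (fun y => f y + g y) (df + dg).
Proof. exact: is_deriveD. Qed.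

Lemma is_deriveB_fun f g x (df dg : R) : is_derive x 1 f df -> is_derive x 1 g dg ->
  is_derive x 1 (fun y => f y - g y) (df - dg).
Proof. exact: is_deriveB. Qed.

Lemma is_deriveN_fun f x (df : R) : is_derive x 1 f df ->
  is_derive x 1 (fun y => - f y) (- df).
Proof. exact: is_deriveN. Qed.

Lemma is_deriveZ_fun f c x (df : R) : is_derive x 1 f df ->
  is_derive x 1 (fun y => c * f y) (c * df).
Proof. exact: is_deriveZ. Qed.

Lemma is_deriveM_fun f g x (df dg : R) : is_derive x 1 f df -> is_derive x 1 g dg ->
  is_derive x 1 (fun y => f y * g y) (f x * dg + g x * df).
Proof. exact: is_deriveM. Qed.

Lemma is_deriveV_fun f x (df : R) : f x != 0 -> is_derive x 1 f df ->
  is_derive x 1 (fun y => (f y)^-1) (- (f x ^- 2) * df).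
Proof. exact: is_deriveV. Qed.

Lemma is_derive_cosF F x (dF : R) : is_derive x 1 F dF ->
  is_derive x 1 (fun y => cos (F y)) (- sin (F x) * dF).
Proof. by move=> h; exact: is_derive1_comp. Qed.

Lemma is_derive_sinF F x (dF : R) : is_derive x 1 F dF ->
  is_derive x 1 (fun y => sin (F y)) (cos (F x) * dF).
Proof. by move=> h; exact: is_derive1_comp. Qed.

Lemma is_derive_reflect f x (df : R) : is_derive (- x) 1 f df ->
  is_derive x 1 (fun y => f (- y)) (- df).
Proof.
move=> h; rewrite -mulrN1.
by apply: (@is_derive1_comp _ f -%R) => //; exact: is_derive_eq (is_deriveNid x 1) _.
Qed.

Lemma is_derive_within_continuous f (df : R -> R) a b :
  (forall x, a <= x <= b -> is_derive x 1 f (df x)) -> {within `[a, b], continuous f}.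
Proof.
move=> h; apply: derivable_within_continuous => x; rewrite in_itv /= => xab.
by have [] := h x xab.
Qed.

(** Monotonicity of the integral, stated on primitives: the mean value theorem is applied to
    [g - f], whose derivative is nonnegative. *)
Lemma is_derive_le f g (df dg : R -> R) a b : a <= b ->
  (forall x, a <= x <= b -> is_derive x 1 f (df x)) ->
  (forall x, a <= x <= b -> is_derive x 1 g (dg x)) ->
  (forall x, a <= x <= b -> df x <= dg x) -> f b - f a <= g b - g a.
Proof.
move=> ab hf hg le.
have h x : a <= x <= b -> is_derive x 1 (fun y => g y - f y) (dg x - df x).
  by move=> xab; apply: is_deriveB_fun; [exact: hg|exact: hf].
have [||c] := @MVT_segment _ (fun y => g y - f y) (fun x => dg x - df x) a b ab.
- by move=> x; rewrite in_itv /= => /andP[ax xb]; apply: h; rewrite !ltW.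
- exact: is_derive_within_continuous h.
rewrite in_itv /= => cab e.
have : 0 <= (dg c - df c) * (b - a) by rewrite mulr_ge0 // subr_ge0 // le.
rewrite -e; lra.
Qed.

Lemma is_derive_norm_le f g (df dg : R -> R) a b : a <= b ->
  (forall x, a <= x <= b -> is_derive x 1 f (df x)) ->
  (forall x, a <= x <= b -> is_derive x 1 g (dg x)) ->
  (forall x, a <= x <= b -> `|df x| <= dg x) -> `|f b - f a| <= g b - g a.
Proof.
move=> ab hf hg le; rewrite ler_norml; apply/andP; split; last first.
  by apply: is_derive_le ab hf hg _ => x /le; rewrite ler_norml => /andP[].
rewrite lerNl.
have -> : - (f b - f a) = (- f b) - (- f a) by rewrite opprB opprK addrC.
apply: (@is_derive_le (fun x => - f x) g (fun x => - df x) dg a b ab _ hg) => x xab.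
- by apply: is_deriveN_fun; exact: hf.
- by move: (le x xab); rewrite ler_norml lerNl => /andP[].
Qed.

Lemma is_derive_lipschitz f (df : R -> R) (k : R) a b : a <= b ->
  (forall x, a <= x <= b -> is_derive x 1 f (df x)) ->
  (forall x, a <= x <= b -> `|df x| <= k) -> `|f b - f a| <= k * (b - a).
Proof.
move=> ab hf le; rewrite mulrBr.
apply: (@is_derive_norm_le f (fun x => k * x) df (fun=> k) a b ab) => // x _.
by apply: (is_derive_eq (is_deriveZ_fun k (is_derive_id x 1))); rewrite mulr1.
Qed.

Lemma continuous_primitive f a b : a <= b -> continuous f ->
  exists F, forall x, a <= x <= b -> is_derive x 1 F (f x).
Proof.
move=> ab cf.
(* Starting the integral at [a - 1] makes every point of [[a, b]], endpoints included, interior to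
   [[a - 1, b + 1]], so the derivative is two-sided. *)
pose F x := (\int[@lebesgue_measure R]_(t in `[(a - 1), x]) f t)%R.
exists F => x /andP[ax xb].
have xu : x < b + 1 by rewrite (le_lt_trans xb) // ltrDl.
have ax' : a - 1 < x by rewrite (lt_le_trans _ ax) // gtrBl.
have int : (@lebesgue_measure R).-integrable `[a - 1, b + 1] (EFin \o f).
  apply: continuous_compact_integrable; first exact: segment_compact.
  exact: continuous_subspaceT.
have [dF eF] := continuous_FTC1_closed xu int ax' (cf x).
exact: DeriveDef dF (etrans (esym (derive1E _ _)) eF).
Qed.

End Derivatives.

(** * Van der Corput's derivative tests *)

Section VanDerCorput.
Context {R : realType}.

(* [P] plays the role of [int cos F]; [F1] and [F2] are the derivatives of [F]. *)
Definition oscillatory (P F F1 F2 : R -> R) (a b : R) := forall x, a <= x <= b ->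
  [/\ is_derive x 1 P (cos (F x)), is_derive x 1 F (F1 x) & is_derive x 1 F1 (F2 x)].

Lemma oscillatory_sub P F F1 F2 a b c d : a <= c -> d <= b ->
  oscillatory P F F1 F2 a b -> oscillatory P F F1 F2 c d.
Proof.
by move=> ac db h x /andP[cx xd]; apply: h; rewrite (le_trans ac) ?(le_trans xd).
Qed.

Lemma oscillatory_opp P F F1 F2 a b : oscillatory P F F1 F2 a b ->
  oscillatory P (fun x => - F x) (fun x => - F1 x) (fun x => - F2 x) a b.
Proof.
by move=> h x /h[hP hF hF1]; split; [rewrite cosN|exact: is_deriveN|exact: is_deriveN].
Qed.

Lemma oscillatory_reflect P F F1 F2 a b : oscillatory P F F1 F2 a b ->
  oscillatory (fun x => - P (- x)) (fun x => F (- x)) (fun x => - F1 (- x))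
    (fun x => F2 (- x)) (- b) (- a).
Proof.
move=> h x /andP[bx xa]; have [|hP hF hF1] := h (- x).
  by rewrite lerNr xa lerNl bx.
split.
- by rewrite -[cos _]opprK; apply: is_deriveN_fun; exact: is_derive_reflect.
- exact: is_derive_reflect.
- by rewrite -[F2 _]opprK; apply: is_deriveN_fun; exact: is_derive_reflect.
Qed.

Lemma oscillatory_trivial P F F1 F2 a b : a <= b -> oscillatory P F F1 F2 a b ->
  `|P b - P a| <= b - a.
Proof.
move=> ab h; rewrite -[b - a]mul1r.
apply: (@is_derive_lipschitz _ P (fun x => cos (F x)) 1 a b ab) => [x /h[] //|x _].
exact: cos_max.
Qed.

(* [P - sin F / F'] has derivative [sin F * F'' / F' ^ 2], which is dominated by
   the derivative of [- 1 / F']. *)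
Lemma van_der_corput1 P F F1 F2 a b (eta : R) : a <= b -> 0 < eta ->
  oscillatory P F F1 F2 a b ->
  (forall x, a <= x <= b -> eta <= F1 x) ->
  (forall x, a <= x <= b -> 0 <= F2 x) -> `|P b - P a| <= 3 * eta^-1.
Proof.
move=> ab eta0 h F1ge F2ge.
have F1gt0 x : a <= x <= b -> 0 < F1 x by move=> /F1ge; exact: lt_le_trans.
have F1V x : a <= x <= b -> 0 <= (F1 x)^-1 <= eta^-1.
  move=> xab; rewrite invr_ge0 ltW ?F1gt0 //= lef_pV2 ?posrE ?F1gt0 //.
  exact: F1ge.
pose Q x := P x - sin (F x) * (F1 x)^-1.
have : `|Q b - Q a| <= (- (F1 b)^-1) - (- (F1 a)^-1).
  apply: (@is_derive_norm_le _ Q (fun x => - (F1 x)^-1)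
    (fun x => sin (F x) * (F1 x ^- 2 * F2 x)) (fun x => F1 x ^- 2 * F2 x) a b ab).
  - move=> x xab; have [hP hF hF1] := h x xab.
    have F1n0 : F1 x != 0 by rewrite gt_eqF // F1gt0.
    apply: is_derive_eq (is_deriveB_fun hP
      (is_deriveM_fun (is_derive_sinF hF) (is_deriveV_fun F1n0 hF1))) _.
    by field.
  - move=> x xab; have [hP hF hF1] := h x xab.
    have F1n0 : F1 x != 0 by rewrite gt_eqF // F1gt0.
    apply: is_derive_eq (is_deriveN_fun (is_deriveV_fun F1n0 hF1)) _.
    by rewrite mulNr opprK.
  - move=> x xab; have p : 0 <= F1 x ^- 2 * F2 x.
      by rewrite mulr_ge0 ?F2ge // invr_ge0 sqr_ge0.
    by rewrite normrM (ger0_norm p) ler_piMl // sin_max.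
(* Three contributions of size at most [eta^-1] remain: the variation of [Q], and the boundary terms
   [sin F / F1] at [a] and at [b]. *)
have aab : a <= a <= b by rewrite lexx.
have bab : a <= b <= b by rewrite lexx andbT.
have bnd x : a <= x <= b -> `|sin (F x) * (F1 x)^-1| <= (F1 x)^-1.
  by move=> /F1V/andP[p _]; rewrite normrM (ger0_norm p) ler_piMl // sin_max.
have := bnd a aab; have := bnd b bab; have := F1V a aab; have := F1V b bab.
rewrite /Q; set sa := sin (F a) * _; set sb := sin (F b) * _.
rewrite !ler_norml => /andP[? ?] /andP[? ?] /andP[? ?] /andP[? ?] /andP[? ?].
apply/andP; split; lra.
Qed.

(** Here [mu] is a length. The piece [[a, a + mu]] costs at most [mu] trivially; past it [F1] has
    grown to at least [mu ^- 2 * mu = mu^-1], so the first derivative test costs [3 * mu]. *)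
Lemma van_der_corput2_incr P F F1 F2 a b (mu : R) : a <= b -> 0 < mu ->
  oscillatory P F F1 F2 a b -> 0 <= F1 a ->
  (forall x, a <= x <= b -> mu ^- 2 <= F2 x) -> `|P b - P a| <= 4 * mu.
Proof.
move=> ab mu0 h F1a F2ge.
have F2ge0 x : a <= x <= b -> 0 <= F2 x.
  by move=> /F2ge; apply: le_trans; rewrite invr_ge0 sqr_ge0.
have [small|large] := leP b (a + mu).
  by apply: le_trans (oscillatory_trivial ab h) _; lra.
have am : a <= a + mu by rewrite lerDl ltW.
have -> : P b - P a = (P b - P (a + mu)) + (P (a + mu) - P a) by ring.
apply: le_trans (ler_normD _ _) _.
have -> : 4 * mu = 3 * (mu^-1)^-1 + mu by rewrite invrK; ring.
apply: lerD; last first.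
  apply: le_trans (oscillatory_trivial am (oscillatory_sub (lexx _) (ltW large) h)) _.
  by rewrite addrAC subrr add0r.
apply: (@van_der_corput1 P F F1 F2) => //.
- exact: ltW.
- by rewrite invr_gt0.
- exact: oscillatory_sub am (lexx _) h.
- move=> x /andP[mx xb]; have ax : a <= x := le_trans am mx.
  have : (mu ^- 2 * x) - (mu ^- 2 * a) <= F1 x - F1 a.
    apply: (@is_derive_le _ (fun y => mu ^- 2 * y) F1 (fun=> mu ^- 2) F2 a x ax) => y /andP[ay yx].
    - by apply: (is_derive_eq (is_deriveZ_fun _ (is_derive_id y 1))); rewrite mulr1.
    - by have [] := h y _; rewrite ?ay ?(le_trans yx).
    - by apply: F2ge; rewrite ay (le_trans yx).
  have : mu ^- 2 * mu <= mu ^- 2 * (x - a).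
    by rewrite ler_wpM2l ?invr_ge0 ?sqr_ge0 // lerBrDl.
  have -> : mu ^- 2 * mu = mu^-1 by field; rewrite gt_eqF.
  by rewrite mulrBr; lra.
- by move=> x /andP[mx xb]; apply: F2ge0; rewrite (le_trans am).
Qed.

(** The reflection [x -> - x] preserves [F2] and turns [F1] into [- F1 (- x)], nonnegative at the
    new left end, which reduces this to the increasing case. *)
Lemma van_der_corput2_decr P F F1 F2 a b (mu : R) : a <= b -> 0 < mu ->
  oscillatory P F F1 F2 a b -> F1 b <= 0 ->
  (forall x, a <= x <= b -> mu ^- 2 <= F2 x) -> `|P b - P a| <= 4 * mu.
Proof.
move=> ab mu0 /oscillatory_reflect h F1b F2ge.
have := @van_der_corput2_incr _ _ _ _ (- b) (- a) mu _ mu0 h.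
rewrite !opprK lerN2 oppr_ge0 addrC => -> // x /andP[bx xa].
by apply: F2ge; rewrite lerNr xa lerNl bx.
Qed.

(** If [F1] changes sign, the interval is cut at a zero of [F1], the stationary point of the phase,
    and each half costs [4 * mu]. *)
Lemma van_der_corput2_pos P F F1 F2 a b (mu : R) : a <= b -> 0 < mu ->
  oscillatory P F F1 F2 a b ->
  (forall x, a <= x <= b -> mu ^- 2 <= F2 x) -> `|P b - P a| <= 8 * mu.
Proof.
move=> ab mu0 h F2ge.
have [F1a|F1a] := leP 0 (F1 a).
  by apply: le_trans (van_der_corput2_incr ab mu0 h F1a F2ge) _; lra.
have [F1b|F1b] := leP (F1 b) 0.
  by apply: le_trans (van_der_corput2_decr ab mu0 h F1b F2ge) _; lra.
have cF1 : {within `[a, b], continuous F1}.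
  by apply: (@is_derive_within_continuous _ F1 F2) => x /h[].
have [|c] := IVT ab cF1 (v := 0).
  by rewrite ge_min (ltW F1a) le_max (ltW F1b) orbT.
rewrite in_itv /= => /andP[ac cb] F1c.
have -> : P b - P a = (P b - P c) + (P c - P a) by ring.
apply: le_trans (ler_normD _ _) _.
have -> : 8 * mu = 4 * mu + 4 * mu by ring.
apply: lerD.
- apply: van_der_corput2_incr cb mu0 (oscillatory_sub ac (lexx _) h) _ _.
    by rewrite F1c.
  by move=> x /andP[cx xb]; apply: F2ge; rewrite (le_trans ac).
- apply: van_der_corput2_decr ac mu0 (oscillatory_sub (lexx _) cb h) _ _.
    by rewrite F1c.
  by move=> x /andP[cx xb]; apply: F2ge; rewrite cx (le_trans xb).
Qed.

Lemma van_der_corput2 P F F1 F2 a b (mu : R) : a <= b -> 0 < mu ->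
  oscillatory P F F1 F2 a b ->
  (forall x, a <= x <= b -> mu ^- 2 <= F2 x) \/
  (forall x, a <= x <= b -> F2 x <= - mu ^- 2) -> `|P b - P a| <= 8 * mu.
Proof.
move=> ab mu0 h [F2ge|F2le]; first exact: van_der_corput2_pos h F2ge.
(* The cosine is even: negating the phase keeps [P] and flips the sign of [F2]. *)
apply: van_der_corput2_pos ab mu0 (oscillatory_opp h) _ => x /F2le.
by rewrite lerNr.
Qed.

(** Allows the second derivative to degenerate at the ends: the two end pieces cost [eps] each, and
    if they overlap the whole interval is shorter than [2 * eps]. *)
Lemma van_der_corput2_trim P F F1 F2 a b (mu eps : R) : a <= b -> 0 < mu -> 0 <= eps ->
  oscillatory P F F1 F2 a b ->
  (forall x, a + eps <= x <= b - eps -> mu ^- 2 <= F2 x) \/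
  (forall x, a + eps <= x <= b - eps -> F2 x <= - mu ^- 2) ->
  `|P b - P a| <= 8 * mu + 2 * eps.
Proof.
move=> ab mu0 eps0 h hF2.
have [sep|close] := leP (a + eps) (b - eps); last first.
  by apply: le_trans (oscillatory_trivial ab h) _; lra.
have -> : P b - P a = (P b - P (b - eps)) + (P (b - eps) - P (a + eps)) +
  (P (a + eps) - P a) by ring.
have l1 : `|P b - P (b - eps)| <= eps.
  have := @oscillatory_trivial P F F1 F2 (b - eps) b.
  rewrite subKr; apply; first lra.
  apply: oscillatory_sub h; lra.
have l2 : `|P (a + eps) - P a| <= eps.
  have := @oscillatory_trivial P F F1 F2 a (a + eps).
  rewrite [a + eps - a]addrAC subrr add0r; apply; first lra.
  apply: oscillatory_sub h; lra.
have l3 : `|P (b - eps) - P (a + eps)| <= 8 * mu.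
  apply: (@van_der_corput2 P F F1 F2) => //; apply: oscillatory_sub h; lra.
apply: le_trans (ler_normD _ _) _; apply: le_trans (lerD (ler_normD _ _) (lexx _)) _.
lra.
Qed.

End VanDerCorput.

(** * The phase and its degenerate critical points *)

Section Phase.
Context {R : realType}.
Implicit Types (x y t eps : R).

(** Comparing derivatives gives [x * cos x <= sin x], enough when [cos x >= 1/4]. Otherwise [sin x]
    is close to 1, while [x / 4 < 1/2]. *)
Lemma sin_ge_quarter x : 0 <= x <= pi / 2 -> x / 4 <= sin x.
Proof.
move=> /andP[x0 xpi]; have := @pihalf_lt2 R => pi2.
have sge0 y : 0 <= y <= x -> 0 <= sin y.
  by move=> /andP[y0 yx]; apply: sin_ge0_pi; rewrite y0 /=; lra.
have c0 : 0 <= cos x by apply: cos_ge0_pihalf; lra.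
have s0 : 0 <= sin x by apply: sge0; rewrite x0 lexx.
have scos : x * cos x <= sin x.
  have := @is_derive_le _ (fun y => y * cos y) (@sin R)
    (fun y => y * - sin y + cos y * 1) (@cos R) 0 x x0.
  rewrite mul0r sin0 !subr0; apply => y /andP[y0 yx].
  by rewrite mulr1 gerDr mulrN oppr_le0 mulr_ge0 ?sge0 ?y0.
have [cge|clt] := leP (4^-1) (cos x).
  by apply: le_trans scos; rewrite ler_wpM2l.
have := sin_le1 x; have := cos2Dsin2 x; rewrite !expr2 => ? ?; nra.
Qed.

(** The difference is [2 * sin ((y + x) / 2) * sin ((y - x) / 2)]. The first sine exceeds the second
    by [2 * cos (y / 2) * sin (x / 2) >= 0], and the second is at least [(y - x) / 8]; hence the
    factor 2 / 64. *)
Lemma cosB_ge_sqr x y : 0 <= x -> x <= y -> y <= pi ->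
  (y - x) ^+ 2 / 32 <= cos x - cos y.
Proof.
move=> x0 xy ypi.
have sq : 0 <= (y - x) / 2 / 4 <= sin ((y - x) / 2).
  by rewrite sin_ge_quarter ?andbT; lra.
have sp : sin ((y - x) / 2) <= sin ((y + x) / 2).
  rewrite !mulrBl !mulrDl sinB sinD.
  have : 0 <= cos (y / 2) * sin (x / 2).
    by rewrite mulr_ge0 // ?cos_ge0_pihalf ?sin_ge0_pi //; lra.
  lra.
have -> : cos x - cos y = 2 * sin ((y + x) / 2) * sin ((y - x) / 2).
  have {1}-> : x = (y + x) / 2 - (y - x) / 2 by field.
  have {3}-> : y = (y + x) / 2 + (y - x) / 2 by field.
  by rewrite cosB cosD; ring.
move: sq sp => /andP[]; set p := sin _; set q := sin _; set d := y - x.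
rewrite expr2 => d0 dq qp; nra.
Qed.

(** The slope [c] absorbs the Fourier mode [cos (n x)], and the shift [th] selects the real or the
    imaginary part of the exponential. *)
Definition phase t c th y : R := t * (2 * cos y - 2) ^+ 2 + c * y + th.

(** The second derivative of [phase], free of [c] and [th]: this is the source of uniformity in the
    lattice site. *)
Definition phase2 t y : R := t * (8 * (1 - cos y) * (1 + 2 * cos y)).

Lemma oscillatory_phase P t c th a b :
  (forall x, a <= x <= b -> is_derive x 1 P (cos (phase t c th x))) ->
  oscillatory P (phase t c th)
    (fun y => t * (8 * (1 - cos y) * sin y) + c) (phase2 t) a b.
Proof.
move=> h x xab; have dc := is_derive_cos x; have ds := is_derive_sin x.
have d1 : is_derive x 1 (fun y : R => y) 1 := is_derive_id x 1.
have d0 (k : R) : is_derive x 1 (fun=> k) 0 := is_derive_cst k x 1.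
split; first exact: h.
- have -> : phase t c th = fun y => t * ((2 * cos y - 2) * (2 * cos y - 2)) + c * y + th.
    by apply/funext => y; rewrite /phase expr2.
  have dw := is_deriveB_fun (is_deriveZ_fun 2 dc) (d0 2).
  apply: (is_derive_eq (is_deriveD_fun (is_deriveD_fun
    (is_deriveZ_fun t (is_deriveM_fun dw dw)) (is_deriveZ_fun c d1)) (d0 th))).
  by ring.
- apply: (is_derive_eq (is_deriveD_fun (is_deriveZ_fun t (is_deriveM_fun
    (is_deriveZ_fun 8 (is_deriveB_fun (d0 1) dc)) ds)) (d0 c))).
  rewrite /phase2; have := cos2Dsin2 x; move/(canRL (addKr _)) => e.
  have -> : t * (8 * (1 - cos x) * cos x + sin x * (8 * (0 - - sin x))) + 0 =
    t * (8 * (1 - cos x) * cos x + 8 * sin x ^+ 2) by ring.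
  by rewrite e; ring.
Qed.

(* The degenerate critical points of the phase on [0, pi] are [0] and [acos (- 1/2)]. *)
Lemma oscillatory_integral_le P t c th : t != 0 ->
  (forall x, 0 <= x <= pi -> is_derive x 1 P (cos (phase t c th x))) ->
  `|P pi - P 0| <= 36 * `|t| `^ (- 4^-1).
Proof.
move=> t0 /oscillatory_phase h; set eps := _ `^ _.
have tn0 : 0 < `|t| by rewrite normr_gt0.
have eps0 : 0 < eps by rewrite powR_gt0.
(* Since [|t| * eps ^+ 4 = 1], the lower bound on the second derivative is [mu ^- 2] with
   [mu = 2 * eps]. Each of the two arcs then costs [8 * mu + 2 * eps = 18 * eps]. *)
have teps : `|t| * (eps ^+ 2 / 4) = (2 * eps) ^- 2.
  have e4 : `|t| * eps ^+ 4 = 1.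
    rewrite /eps -powR_mulrn ?powR_ge0 // -powRrM mulNr mulVf ?pnatr_eq0 //.
    by rewrite powR_inv1 ?ltW // mulfV // gt_eqF.
  have -> : `|t| * (eps ^+ 2 / 4) = (`|t| * eps ^+ 4) * (2 * eps) ^- 2.
    by field; rewrite gt_eqF.
  by rewrite e4 mul1r.
have zle1 : -1 <= - (2 : R)^-1 <= 1 by lra.
pose z : R := acos (- 2^-1); have z0 : 0 <= z := acos_ge0 zle1.
have zpi : z <= pi := acos_lepi zle1.
have cz : cos z = - 2^-1 by apply: acosK; rewrite in_itv.
have lower x : 0 + eps <= x <= z - eps ->
    eps ^+ 2 / 4 <= 8 * (1 - cos x) * (1 + 2 * cos x).
  rewrite add0r => /andP[ex xz].
  have x0 : 0 <= x by lra.
  have xz' : x <= z by lra.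
  have := cosB_ge_sqr (lexx 0) x0 (le_trans xz' zpi); rewrite cos0 subr0.
  have := cosB_ge_sqr x0 xz' zpi; rewrite cz.
  have : eps ^+ 2 <= x ^+ 2 by apply: lerXn2r; rewrite ?nnegrE; lra.
  have : eps ^+ 2 <= (z - x) ^+ 2.
    by apply: lerXn2r; rewrite ?nnegrE; lra.
  have : 0 <= eps ^+ 2 by rewrite sqr_ge0.
  set E := eps ^+ 2; set X := x ^+ 2; set Z := (z - x) ^+ 2; set k := cos x.
  (* The two factors are never small together: if [cos x >= 0] then [1 + 2 cos x >= 1] and
     [8 (1 - cos x) >= eps^2 / 4]; if [cos x < 0] then [1 - cos x >= 1] and the other factor is at
     least [eps^2 / 16]. *)
  by move=> ? ? ? ? ?; have [?|?] := leP 0 k; nra.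
have upper x : z + eps <= x <= pi - eps ->
    8 * (1 - cos x) * (1 + 2 * cos x) <= - (eps ^+ 2 / 4).
  move=> /andP[zx xpi].
  have zx' : z <= x by lra.
  have := cosB_ge_sqr z0 zx'; rewrite cz => h1; have := h1 ltac:(lra).
  have : eps ^+ 2 <= (x - z) ^+ 2.
    by apply: lerXn2r; rewrite ?nnegrE; lra.
  have : 0 <= eps ^+ 2 by rewrite sqr_ge0.
  (* Beyond [z] only the second factor degenerates, as [1 - cos x >= 3/2]. *)
  set E := eps ^+ 2; set Z := (x - z) ^+ 2; set k := cos x => ? ? ?; nra.
have eps2 : 0 < 2 * eps by rewrite mulr_gt0.
have -> : P pi - P 0 = (P pi - P z) + (P z - P 0) by ring.
apply: le_trans (ler_normD _ _) _.
have -> : 36 * eps = (8 * (2 * eps) + 2 * eps) + (8 * (2 * eps) + 2 * eps) by ring.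
(* The sign of [t] decides on which arc the phase is convex and on which it is concave. *)
have [tpos|tneg] := ltP 0 t.
- rewrite (gtr0_norm tpos) in teps; apply: lerD.
  + apply: van_der_corput2_trim zpi eps2 (ltW eps0) (oscillatory_sub z0 (lexx _) h) _.
    by right=> x /upper le; rewrite -teps -mulrN ler_wpM2l // ltW.
  + apply: van_der_corput2_trim z0 eps2 (ltW eps0) (oscillatory_sub (lexx _) zpi h) _.
    by left=> x /lower le; rewrite -teps ler_wpM2l // ltW.
- rewrite (ler0_norm tneg) in teps; apply: lerD.
  + apply: van_der_corput2_trim zpi eps2 (ltW eps0) (oscillatory_sub z0 (lexx _) h) _.
    by left=> x /upper le; rewrite -teps mulNr -mulrN ler_wnM2l.
  + apply: van_der_corput2_trim z0 eps2 (ltW eps0) (oscillatory_sub (lexx _) zpi h) _.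
    by right=> x /lower le; rewrite -teps mulNr opprK ler_wnM2l.
Qed.

End Phase.

(** * Means over the half period *)

Section Mean.
Context {R : realType}.
Implicit Types (f g F : R -> R).

(** For an even 2pi-periodic function this is its zeroth Fourier coefficient; the symbols below are
    even, so the half period suffices. *)
Definition mean0pi f : R := pi^-1 * \int[@lebesgue_measure R]_(x in `[0, pi]) f x.

Lemma mean0piE f F : continuous f ->
  (forall x, 0 <= x <= pi -> is_derive x 1 F (f x)) ->
  mean0pi f = pi^-1 * (F pi - F 0).
Proof.
move=> cf dF; congr (_ * _); rewrite /Rintegral.
have [_ l r] := (continuous_within_itvP F (@pi_gt0 R)).1 (is_derive_within_continuous dF).
have sub x : x \in `]0, pi[ -> is_derive x 1 F (f x).
  by rewrite in_itv /= => /andP[x0 xpi]; apply: dF; rewrite !ltW.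
rewrite (continuous_FTC2 (@pi_gt0 R) _ _ _ (F := F)) //.
- exact: continuous_subspaceT.
- by split; [move=> x /sub[]|exact: l|exact: r].
- by move=> x /sub[]; rewrite derive1E.
Qed.

Lemma mean0piP f : continuous f -> exists2 F,
  forall x, 0 <= x <= pi -> is_derive x 1 F (f x) & mean0pi f = pi^-1 * (F pi - F 0).
Proof.
move=> cf; have [F dF] := continuous_primitive (@pi_ge0 R) cf.
by exists F => //; exact: mean0piE.
Qed.

Lemma mean0piD f g : continuous f -> continuous g ->
  mean0pi (fun x => f x + g x) = mean0pi f + mean0pi g.
Proof.
move=> cf cg; have [F dF ->] := mean0piP cf; have [G dG ->] := mean0piP cg.
have c : continuous (fun x => f x + g x) by move=> x; exact: cvgD (cf x) (cg x).
rewrite (mean0piE c (fun x xpi => is_deriveD_fun (dF x xpi) (dG x xpi))); ring.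
Qed.

Lemma mean0piZ (k : R) f : continuous f ->
  mean0pi (fun x => k * f x) = k * mean0pi f.
Proof.
move=> cf; have [F dF ->] := mean0piP cf.
have c : continuous (fun x => k * f x).
  by move=> x; apply: cvgM (cf x); exact: cvg_cst.
rewrite (mean0piE c (fun x xpi => is_deriveZ_fun k (dF x xpi))); ring.
Qed.

Lemma mean0pi0 : mean0pi (fun=> 0) = 0.
Proof.
have c : continuous (fun _ : R => 0 : R) by move=> x; exact: cvg_cst.
by rewrite (mean0piE c (fun x _ => is_derive_cst 0 x 1)) subrr mulr0.
Qed.

Lemma mean0pi_sum N (f : nat -> R -> R) : (forall k, continuous (f k)) ->
  mean0pi (fun x => \sum_(k < N) f k x) = \sum_(k < N) mean0pi (f k).
Proof.
move=> cf; have cS M : continuous (fun x => \sum_(k < M) f k x).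
  move=> x; elim: M => [|M IH].
    by under eq_fun do rewrite big_ord0; exact: cvg_cst.
  by under eq_fun do rewrite big_ord_recr /=; apply: cvgD => //; exact: cf.
elim: N => [|N IH].
  by rewrite big_ord0 -[RHS]mean0pi0; congr mean0pi; apply/funext => x; rewrite big_ord0.
rewrite big_ord_recr /= -IH -mean0piD //.
by congr mean0pi; apply/funext => x; rewrite big_ord_recr.
Qed.

Lemma mean0pi_dist f g (e : R) : continuous f -> continuous g ->
  (forall x, `|f x - g x| <= e) -> `|mean0pi f - mean0pi g| <= e.
Proof.
move=> cf cg le; have [F dF ->] := mean0piP cf; have [G dG ->] := mean0piP cg.
rewrite -mulrBr normrM gtr0_norm ?invr_gt0 ?pi_gt0 //.
rewrite ler_pdivrMl ?pi_gt0 // mulrC.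
have -> : F pi - F 0 - (G pi - G 0) = (F pi - G pi) - (F 0 - G 0) by ring.
rewrite -[pi in leRHS]subr0.
apply: (@is_derive_lipschitz _ (fun x => F x - G x) (fun x => f x - g x) e).
- exact: pi_ge0.
- by move=> x xpi; exact: is_deriveB_fun (dF x xpi) (dG x xpi).
- by move=> x _; exact: le.
Qed.

Lemma sin_int_pi (n : int) : sin (n%:~R * pi) = 0 :> R.
Proof.
have nat m : sin (m%:R * pi) = 0 :> R.
  by rewrite mulr_natl -[_ *+ _]add0r (alternatingn (@sinDpi R)) sin0 mulr0.
case: n => m; first exact: nat.
by rewrite NegzE mulrNz mulNr sinN nat oppr0.
Qed.

Lemma continuous_cosM (k : R) : continuous (fun x : R => cos (k * x)).
Proof.
move=> x; apply: differentiable_continuous; apply/derivable1_diffP.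
by have [] := is_derive_cosF (is_deriveZ_fun k (is_derive_id x (1 : R))).
Qed.

Lemma mean0pi_cos (n : int) : mean0pi (fun x => cos (n%:~R * x)) = (n == 0)%:R.
Proof.
have cc := @continuous_cosM n%:~R.
have [n0|n0] := eqVneq n 0.
  have d x : 0 <= x <= pi -> is_derive x (1 : R) (fun y : R => y) (cos (n%:~R * x)).
    by move=> _; rewrite n0 mul0r cos0; exact: is_derive_id.
  by rewrite (mean0piE cc d) subr0 mulVf // gt_eqF // pi_gt0.
have n0' : n%:~R != 0 :> R by rewrite intr_eq0.
have d x : 0 <= x <= pi ->
    is_derive x (1 : R) (fun x => (n%:~R)^-1 * sin (n%:~R * x)) (cos (n%:~R * x)).
  move=> _; apply: (is_derive_eq (is_deriveZ_fun _
    (is_derive_sinF (is_deriveZ_fun n%:~R (is_derive_id x 1))))).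
  by rewrite /=; field.
by rewrite (mean0piE cc d) sin_int_pi !mulr0 sin0 mulr0 subrr mulr0.
Qed.

End Mean.

(** * Fourier representation of powers of the Laplacian *)

Section Fourier.
Context {R : realType}.

Definition symbol (x : R) : R := 2 * cos x - 2.

(* The value at [n] of the [k]-th Laplacian of the delta sequence at [0]. *)
Definition laplacian_kernel (k : nat) (n : int) : R :=
  mean0pi (fun x : R => cos (n%:~R * x) * symbol x ^+ k).

Lemma continuous_symbol : continuous symbol.
Proof.
move=> x; apply: cvgB; last exact: cvg_cst.
by apply: cvgM; [exact: cvg_cst|exact: continuous_cos].
Qed.

Lemma continuous_symbolX k : continuous (fun x : R => symbol x ^+ k).
Proof.
move=> x; elim: k => [|k IH]; first exact: cvg_cst.
by under eq_fun do rewrite exprS; apply: cvgM => //; exact: continuous_symbol.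
Qed.

Lemma continuous_kernel k (n : int) :
  continuous (fun x : R => cos (n%:~R * x) * symbol x ^+ k).
Proof. by move=> x; apply: cvgM; [exact: continuous_cosM|exact: continuous_symbolX]. Qed.

Lemma laplacian_kernel0 (n : int) : laplacian_kernel 0 n = (n == 0)%:R.
Proof.
by rewrite -mean0pi_cos; congr mean0pi; apply/funext => x; rewrite expr0 mulr1.
Qed.

(** From [cos ((n + 1) x) + cos ((n - 1) x) = 2 cos x cos (n x)]: on the Fourier side the Laplacian
    multiplies by [symbol]. *)
Lemma laplacian_kernelS k (n : int) : laplacian_kernel k.+1 n =
  laplacian_kernel k (n + 1) + laplacian_kernel k (n - 1) - 2 * laplacian_kernel k n.
Proof.
rewrite /laplacian_kernel -mulNr -mean0piZ; last exact: continuous_kernel.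
have cs : continuous (fun x : R => cos ((n + 1)%:~R * x) * symbol x ^+ k +
    cos ((n - 1)%:~R * x) * symbol x ^+ k).
  by move=> x; apply: cvgD; exact: continuous_kernel.
rewrite -!mean0piD //; first last.
- exact: continuous_kernel.
- exact: continuous_kernel.
- by move=> x; apply: cvgM; [exact: cvg_cst|exact: continuous_kernel].
congr mean0pi; apply/funext => x.
rewrite rmorphD rmorphB /= mulrDl mulrBl mul1r cosD cosB exprS /symbol; ring.
Qed.

Lemma symbol_sqr_le (x : R) : `|symbol x ^+ 2| <= 16.
Proof.
rewrite normrX; have -> : (16 : R) = 4 ^+ 2 by ring.
rewrite ler_pXn2r ?nnegrE // /symbol ler_norml.
by have := cos_le1 x; have := cos_geN1 x; lra.
Qed.

End Fourier.

(** * Tails of the exponential, cosine and sine series *)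

Section ExponentialTail.
Context {R : realType}.
Implicit Types (u : R^nat) (y Y : R).

(** A common error term for the cosine and sine series, uniform over arguments of modulus at most
    [Y]. *)
Definition exp_tail Y N := limn (series (exp_coeff Y)) - series (exp_coeff Y) N.

Lemma cvg_exp_tail Y : exp_tail Y N @[N --> \oo] --> 0.
Proof.
rewrite -[0](subrr (limn (series (exp_coeff Y)))).
by apply: cvgB; [exact: cvg_cst|exact: is_cvg_series_exp_coeff].
Qed.

Lemma series_tail_le u Y N : 0 <= Y -> (forall k, `|u k| <= exp_coeff Y k) ->
  `|limn (series u) - series u N| <= exp_tail Y N.
Proof.
move=> Y0 le; have cE := is_cvg_series_exp_coeff Y.
have E0 k : 0 <= exp_coeff Y k by exact: exp_coeffM_ge0.
have cu : cvgn (series u).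
  apply: normed_cvg; apply: series_le_cvg cE => // k; exact: normr_ge0.
have c : `|series u m - series u N| @[m --> \oo] --> `|limn (series u) - series u N|.
  by apply: cvg_norm; apply: cvgB => //; exact: cvg_cst.
rewrite -(cvg_lim _ c) //; apply: limr_le; first by apply/cvg_ex; eexists; exact: c.
exists N => // m /= Nm.
apply: (@le_trans _ _ (series (exp_coeff Y) m - series (exp_coeff Y) N)).
  by rewrite !sub_series_geq //; apply: le_trans (ler_norm_sum _ _ _) (ler_sum _ _).
rewrite lerD2r; apply: nondecreasing_cvgn_le => //.
by apply: nondecreasing_series => k _ _.
Qed.

(** With [b] a parity indicator and [j] a halved index, one bound covers both [cos_coeff] and
    [sin_coeff]. *)
Lemma trig_coeff_le (b : bool) (j : nat) Y y k : `|y| <= Y ->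
  `|b%:R * (-1) ^+ j * y ^+ k / k`!%:R| <= exp_coeff Y k.
Proof.
move=> yY; rewrite /exp_coeff /= !normrM normrX normrN1 expr1n mulr1.
rewrite normfV normr_nat [`|k`!%:R|]normr_nat ler_wpM2r ?invr_ge0 // normrX.
apply: (@le_trans _ _ (`|y| ^+ k)).
  by rewrite ler_piMl ?exprn_ge0 // lern1 leq_b1.
by apply: lerXn2r; rewrite ?nnegrE // (le_trans _ yY).
Qed.

Lemma cos_series_tail y Y N : `|y| <= Y ->
  `|cos y - series (cos_coeff y) N| <= exp_tail Y N.
Proof.
move=> yY; rewrite unlock; apply: series_tail_le; first exact: le_trans yY.
by move=> k; exact: trig_coeff_le.
Qed.

Lemma sin_series_tail y Y N : `|y| <= Y ->
  `|sin y - series (sin_coeff y) N| <= exp_tail Y N.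
Proof.
move=> yY; rewrite unlock; apply: series_tail_le; first exact: le_trans yY.
by move=> k; exact: trig_coeff_le.
Qed.

Lemma cos_coeffM (t y : R) k : cos_coeff (t * y) k = cos_coeff t k * y ^+ k.
Proof. by rewrite /cos_coeff /= exprMn mulrA mulrAC. Qed.

Lemma sin_coeffM (t y : R) k : sin_coeff (t * y) k = sin_coeff t k * y ^+ k.
Proof. by rewrite /sin_coeff /= exprMn mulrA mulrAC. Qed.

(** Euler's formula for [exp (- i t)], term by term: [(- i)^2 = -1] yields the sign, and an odd [k]
    leaves one factor [- i]. *)
Lemma exp_coeff_imaginary (t : R) k :
  (k`!%:R)^-1 * (- ('i%C * t%:C)) ^+ k = cos_coeff t k +i* - sin_coeff t k.
Proof.
have i2 : (- ('i%C : R[i])) ^+ 2 = -1 by rewrite sqrrN sqr_i.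
rewrite -mulNr exprMn -rmorphXn /= -[k in _ ^+ k]odd_double_half.
rewrite exprD -muln2 mulnC exprM i2.
have -> : (k`!%:R : R[i])^-1 = (k`!%:R^-1 : R)%:C.
  by rewrite fmorphV rmorph_nat.
have -> : (-1 : R[i]) ^+ k./2 = ((-1) ^+ k./2)%:C.
  by rewrite rmorphXn rmorphN1.
rewrite /cos_coeff /sin_coeff /=.
case: (boolP (odd k)) => ok /=.
(* The sine coefficient halves [k - 1] instead of [k]; for odd [k] the two agree. *)
- have -> : k.-1./2 = k./2 by rewrite -{1}[k]odd_double_half ok /= doubleK.
  by simpc; congr (_ +i* _); ring.
- by simpc; congr (_ +i* _); ring.
Qed.

End ExponentialTail.

(** * Kernel of the propagator and its uniform bound *)

Section Propagator.
Context {R : realType}.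
Implicit Types (t th : R) (phi : zseq R).

Lemma continuous_phase t c th : continuous (phase t c th).
Proof.
move=> x; apply: cvgD; last exact: cvg_cst.
apply: cvgD; apply: cvgM; rewrite ?expr2; try exact: cvg_cst; last exact: cvg_id.
exact: (@continuous_symbolX R 2).
Qed.

Lemma continuous_cos_phase t c th : continuous (fun x => cos (phase t c th x)).
Proof.
by move=> x; exact: continuous_comp (@continuous_phase t c th x) (@continuous_cos R _).
Qed.

Lemma mean0pi_cos_phase_le t c th : t != 0 ->
  `|mean0pi (fun x => cos (phase t c th x))| <= 36 * `|t| `^ (- 4^-1).
Proof.
move=> t0; have [P dP ->] := mean0piP (@continuous_cos_phase t c th).
rewrite normrM gtr0_norm ?invr_gt0 ?pi_gt0 // ler_pdivrMl ?pi_gt0 //.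
apply: le_trans (oscillatory_integral_le t0 dP) _.
rewrite ler_peMl ?mulr_ge0 ?powR_ge0 //; have := @pi_ge2 R; lra.
Qed.

(** The product of cosines is the average of the cosines of the phases with slopes [c] and [- c],
    and the bound for each is independent of the slope. *)
Lemma mean0pi_cosM_phase_le t c th : t != 0 ->
  `|mean0pi (fun x => cos (c * x) * cos (phase t 0 th x))| <= 36 * `|t| `^ (- 4^-1).
Proof.
move=> t0.
have -> : mean0pi (fun x => cos (c * x) * cos (phase t 0 th x)) =
    2^-1 * (mean0pi (fun x => cos (phase t c th x)) +
            mean0pi (fun x => cos (phase t (- c) th x))).
  rewrite -mean0piD; try exact: continuous_cos_phase.
  rewrite -mean0piZ; last by move=> x; apply: cvgD; exact: continuous_cos_phase.
  congr mean0pi; apply/funext => x.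
  have -> : phase t c th x = phase t 0 th x + c * x by rewrite /phase; ring.
  have -> : phase t (- c) th x = phase t 0 th x - c * x by rewrite /phase; ring.
  by rewrite cosD cosB; field.
have := @mean0pi_cos_phase_le t c th t0; have := @mean0pi_cos_phase_le t (- c) th t0.
set B := 36 * _; set p := mean0pi _; set q := mean0pi _; rewrite !ler_norml.
lra.
Qed.

(** The finite sum moves inside the mean, where [|cos (j x)| <= 1] lets the uniform error [e]
    survive unchanged. *)
Lemma kernel_series_dist (f : nat -> R) (g : R -> R) (e : R) N (j : int) : continuous g ->
  (forall x, `|\sum_(k < N) f k * (symbol x ^+ 2) ^+ k - g x| <= e) ->
  `|\sum_(k < N) f k * laplacian_kernel k.*2 j -
    mean0pi (fun x => cos (j%:~R * x) * g x)| <= e.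
Proof.
move=> cg le.
have ck k : continuous (fun x : R => f k * (cos (j%:~R * x) * symbol x ^+ k.*2)).
  by move=> x; apply: cvgM; [exact: cvg_cst|exact: continuous_kernel].
have -> : \sum_(k < N) f k * laplacian_kernel k.*2 j =
    \sum_(k < N) mean0pi (fun x : R => f k * (cos (j%:~R * x) * symbol x ^+ k.*2)).
  by apply: eq_bigr => k _; rewrite mean0piZ //; exact: continuous_kernel.
rewrite -(mean0pi_sum N ck); apply: mean0pi_dist.
- move=> x; elim: N {le} => [|N IH].
    by under eq_fun do rewrite big_ord0; exact: cvg_cst.
  by under eq_fun do rewrite big_ord_recr /=; apply: cvgD => //; exact: ck.
- by move=> x; apply: cvgM; [exact: continuous_cosM|exact: cg].
move=> x.
have -> : \sum_(k < N) f k * (cos (j%:~R * x) * symbol x ^+ k.*2) =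
    cos (j%:~R * x) * \sum_(k < N) f k * (symbol x ^+ 2) ^+ k.
  by rewrite mulr_sumr; apply: eq_bigr => k _; rewrite -exprM mul2n mulrCA.
rewrite -mulrBr normrM; apply: le_trans (le x).
by rewrite ler_piMl // cos_max.
Qed.

(** The convolution kernel of the [N]-th partial sum of the exponential series; the index [k.*2]
    appears because the generator is a squared Laplacian. *)
Definition propagator_kernel t N (j : int) : R[i] :=
  \sum_(k < N) (k`!%:R)^-1 * (- ('i%C * t%:C)) ^+ k * (laplacian_kernel k.*2 j)%:C.

Lemma normc_le_ReIm (z : R[i]) :
  Normc.normc z <= `|complex.Re z| + `|complex.Im z|.
Proof.
rewrite -(@ler_pXn2r _ 2) ?nnegrE ?normc_ge0 ?addr_ge0 // sqr_normcE sqrrD.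
by rewrite !real_normK ?num_real // lerD2r lerDl mulrn_wge0 // mulr_ge0.
Qed.

(** Real and imaginary parts are each within one tail of an oscillatory mean bounded by
    [36 * |t|^(-1/4)]. The tail is taken at [16 * |t|] because [symbol ^+ 2 <= 16]. *)
Lemma propagator_kernel_le t N (j : int) : t != 0 ->
  Normc.normc (propagator_kernel t N j) <=
  72 * `|t| `^ (- 4^-1) + 2 * exp_tail (16 * `|t|) N.
Proof.
move=> t0; apply: le_trans (normc_le_ReIm _) _.
have nsym x : `|t * symbol x ^+ 2| <= 16 * `|t|.
  by rewrite normrM mulrC ler_wpM2r // symbol_sqr_le.
have pE th x : phase t 0 th x = t * symbol x ^+ 2 + th.
  by rewrite /phase mul0r addr0.
have ReE : complex.Re (propagator_kernel t N j) =
    \sum_(k < N) cos_coeff t k * laplacian_kernel k.*2 j.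
  rewrite /propagator_kernel (big_morph _ (@Defs.ReD R) (erefl _)); apply: eq_bigr => k _.
  by rewrite exp_coeff_imaginary Defs.ReM /= mulr0 subr0.
have ImE : complex.Im (propagator_kernel t N j) =
    - \sum_(k < N) sin_coeff t k * laplacian_kernel k.*2 j.
  rewrite /propagator_kernel (big_morph _ (@Defs.ImD R) (erefl _)) -sumrN.
  apply: eq_bigr => k _.
  by rewrite exp_coeff_imaginary Defs.ImM /= mulr0 add0r mulNr.
have dRe := @kernel_series_dist (cos_coeff t) (fun x => cos (phase t 0 0 x))
  (exp_tail (16 * `|t|) N) N j (@continuous_cos_phase t 0 0) _.
(* The shift by [- pi / 2] turns the sine into a cosine, so the same estimate applies. *)
have dIm := @kernel_series_dist (sin_coeff t) (fun x => cos (phase t 0 (- (pi / 2)) x))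
  (exp_tail (16 * `|t|) N) N j (@continuous_cos_phase t 0 (- (pi / 2))) _.
have : `|complex.Re (propagator_kernel t N j) -
    mean0pi (fun x => cos (j%:~R * x) * cos (phase t 0 0 x))| <= exp_tail (16 * `|t|) N.
  rewrite ReE; apply: dRe => x; rewrite pE addr0 distrC.
  apply: le_trans (cos_series_tail N (nsym x)).
  rewrite /series /= big_mkord le_eqVlt; apply/orP; left; apply/eqP.
  congr `|_ - _|; apply: eq_bigr => k _.
  by rewrite cos_coeffM.
have : `|complex.Im (propagator_kernel t N j) +
    mean0pi (fun x => cos (j%:~R * x) * cos (phase t 0 (- (pi / 2)) x))| <=
    exp_tail (16 * `|t|) N.
  rewrite ImE addrC distrC; apply: dIm => x; rewrite pE cosBpihalf distrC.
  apply: le_trans (sin_series_tail N (nsym x)).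
  rewrite /series /= big_mkord le_eqVlt; apply/orP; left; apply/eqP.
  congr `|_ - _|; apply: eq_bigr => k _.
  by rewrite sin_coeffM.
have := @mean0pi_cosM_phase_le t j%:~R 0 t0.
have := @mean0pi_cosM_phase_le t j%:~R (- (pi / 2)) t0.
set p := mean0pi _; set q := mean0pi _ => hp hq hIm hRe.
have := ler_normD (complex.Re (propagator_kernel t N j) - q) q.
have := ler_normB (complex.Im (propagator_kernel t N j) + p) p.
rewrite subrK addrK; lra.
Qed.

(** The [k]-th power only sees sites within distance [k], so the convolution is a finite sum. One
    list [s] serves [n - 1], [n] and [n + 1], so the induction merges three sums termwise. *)
Lemma iter_laplacianE k phi (s : seq int) (n : int) : uniq s ->
  (forall m : int, n - k%:Z <= m <= n + k%:Z -> m \in s) ->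
  iter k laplacian phi n = \sum_(m <- s) phi m * (laplacian_kernel k (n - m))%:C.
Proof.
move=> us; elim: k n => [|k IH] n win.
  rewrite (bigD1_seq n) //=; last by apply: win; lia.
  rewrite subrr laplacian_kernel0 eqxx mulr1 big1 ?addr0 // => m mn.
  by rewrite laplacian_kernel0 subr_eq0 eq_sym (negbTE mn) mulr0.
rewrite iterS /laplacian !IH; try by move=> m hm; apply: win; lia.
rewrite mulr_sumr -big_split -sumrB /=; apply: eq_bigr => m _.
rewrite laplacian_kernelS [n + 1 - m]addrAC [n - 1 - m]addrAC.
have E (a b c : R) : (a + b - 2 * c)%:C = a%:C + b%:C - 2 * c%:C :> R[i].
  have -> : (2 : R[i]) = (2 : R)%:C by rewrite rmorph_nat.
  by rewrite -rmorphM -rmorphD -rmorphB.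
rewrite E; ring.
Qed.

Lemma iter_bilaplacianZ (c : R[i]) k phi :
  iter k (fun psi => c \*o bilaplacian psi) phi = c ^+ k \*o iter k.*2 laplacian phi.
Proof.
elim: k => [|k IH]; first by apply/funext => n /=; rewrite mul1r.
rewrite iterS IH; apply/funext => n; rewrite /= /bilaplacian /laplacian /= exprS; ring.
Qed.

Lemma expsum_bilaplacianE t N phi (s : seq int) (n : int) : uniq s ->
  (forall m : int, n - N.*2%:Z <= m <= n + N.*2%:Z -> m \in s) ->
  expsum (fun psi => (- ('i%C * t%:C)) \*o bilaplacian psi) N phi n =
  \sum_(m <- s) phi m * propagator_kernel t N (n - m).
Proof.
move=> us win; rewrite /expsum.
under [RHS]eq_bigr do rewrite /propagator_kernel mulr_sumr.
rewrite exchange_big /=; apply: eq_bigr => k _.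
rewrite iter_bilaplacianZ /= (iter_laplacianE phi us); last first.
  by move=> m hm; apply: win; have := ltn_ord k; lia.
rewrite mulrA mulr_sumr; apply: eq_bigr => m _; ring.
Qed.

Lemma l1_sum_le phi (s : seq int) : (lnorm 1 phi <= 1)%E -> uniq s ->
  \sum_(n <- s) Normc.normc (phi n) <= 1.
Proof.
move=> + us; rewrite /lnorm invr1 poweRe1; last first.
  by apply: esum_ge0 => n _; rewrite lee_fin powR_ge0.
rewrite -lee_fin; apply: le_trans.
have -> : (\sum_(n <- s) Normc.normc (phi n))%:E =
  (\sum_(n \in [set` s]) (Normc.normc (phi n) `^ 1)%:E)%E.
  rewrite -fsbig_seq // -sumEFin; apply: eq_bigr => n _.
  by rewrite powRr1 // normc_ge0.
by apply: ereal_sup_ubound; exists [set` s] => //; split; [exact: finite_seq|exact: subsetT].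
Qed.

(** Each entry has modulus at most 1, so its square is no larger. This places [phi] in l^2, where
    [opexp] is meaningful. *)
Lemma l1_l2le phi : (lnorm 1 phi <= 1)%E -> l2le phi 1.
Proof.
move=> h s us; rewrite expr1n; apply: le_trans (l1_sum_le h us).
apply: ler_sum => n _; rewrite expr2 ler_piMl ?normc_ge0 //.
by have := @l1_sum_le phi [:: n] h isT; rewrite big_seq1.
Qed.

(** Convolution maps l^1 to l^oo with norm at most the supremum of the kernel. *)
Lemma expsum_bilaplacian_le t N phi (n : int) : t != 0 -> (lnorm 1 phi <= 1)%E ->
  Normc.normc (expsum (fun psi => (- ('i%C * t%:C)) \*o bilaplacian psi) N phi n) <=
  72 * `|t| `^ (- 4^-1) + 2 * exp_tail (16 * `|t|) N.
Proof.
move=> t0 h; set B := leRHS.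
(* The window from [n - 2N] to [n + 2N], hence [4N + 1] sites. *)
pose s : seq int := [seq n - N.*2%:Z + i%:Z | i <- iota 0 (N.*2 + N.*2).+1].
have us : uniq s.
  by rewrite map_inj_uniq ?iota_uniq // => i j /addrI[].
rewrite (@expsum_bilaplacianE t N phi s n us); last first.
  move=> m hm; apply/mapP; exists (absz (m - (n - N.*2%:Z))%R); last by lia.
  by rewrite mem_iota; lia.
have B0 : 0 <= B := le_trans (normc_ge0 _) (propagator_kernel_le N 0 t0).
have norm_sum : Normc.normc (\sum_(m <- s) phi m * propagator_kernel t N (n - m)) <=
    \sum_(m <- s) Normc.normc (phi m * propagator_kernel t N (n - m)).
  elim: s {us} => [|m s IH]; first by rewrite !big_nil Normc.normc0.
  by rewrite !big_cons; apply: le_trans (le_normcD _ _) _; rewrite lerD2l.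
apply: le_trans norm_sum _.
apply: (@le_trans _ _ (\sum_(m <- s) Normc.normc (phi m) * B)).
  apply: ler_sum => m _; rewrite Normc.normcM ler_wpM2l ?normc_ge0 //.
  exact: propagator_kernel_le.
by rewrite -mulr_suml ler_piMl // l1_sum_le.
Qed.

End Propagator.

(** * Passage to the limit in the exponential series *)

Theorem theorem3p1 (R : realType) :
  exists C : R, 0 < C /\
    forall t : R, t != 0 ->
      (opnorm 1 +oo (opexp (fun phi => (- ('i%C * t%:C)) \*o bilaplacian phi))
         <= (C * `|t| `^ (- 4^-1))%:E)%E.
Proof.
exists 72; split => // t t0; set A := fun phi => _.
have bA : bounded_op A := bounded_opZ _ bounded_bilaplacian.
apply: ge_ereal_sup => _ [phi /= hphi <-].
apply: ge_ereal_sup => _ [n _ <-]; rewrite lee_fin.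
have l2 := l2le_lty ler01 (l1_l2le hphi).
(* The triangle inequality through the [N]-th partial sum bounds the value at [n]; convergence in
   l^2 operator norm gives pointwise convergence, so both errors vanish as [N] grows. *)
have c : Normc.normc (opexp A phi n - expsum A N phi n) +
    (72 * `|t| `^ (- 4^-1) + 2 * exp_tail (16 * `|t|) N) @[N --> \oo] -->
    0 + (72 * `|t| `^ (- 4^-1) + 2 * 0).
  apply: cvgD; first exact: (is_opexp_cvg n bA (opexpP bA) l2).
  apply: cvgD; first exact: cvg_cst.
  by apply: cvgM; [exact: cvg_cst|exact: cvg_exp_tail].
move: c; rewrite mulr0 addr0 add0r => c; rewrite -(cvg_lim _ c) //.
apply: limr_ge; first by apply/cvg_ex; eexists; exact: c.
apply: nearW => N /=; apply: le_trans (lerD (lexx _) (expsum_bilaplacian_le N n t0 hphi)).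
by rewrite -[in leLHS](subrK (expsum A N phi n) (opexp A phi n)); exact: le_normcD.
Qed.
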